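(* Let $0<\mu\le L$, let $f\in\mathcal{F}_{\mu,L}$ with unique minimizer $x^*$, let $C>0$, $s\ge 0$, $\alpha\in\mathbb{R}$ be constants, let $\beta_t,\gamma_t$ be continuously differentiable real functions of time, and let $X_t$, $t\ge t_0$, be a solution of $$\ddot{X}_t+(\dot\gamma_t+\dot\beta_t)\dot{X}_t+\sqrt{s}\,\nabla^2 f(X_t)\dot{X}_t+\Big(\frac{e^{\alpha}}{C}+\sqrt{s}\,\dot\beta_t\Big)\nabla f(X_t)=0 .$$ (a) If $\dot\gamma_t=\dot\gamma$ is constant and $0\le\dot\beta_t\le\dot\gamma=e^{\alpha}\le \frac{\mu}{C}$ for all $t$, then $f(X_t)-f(x^* )\le\mathcal{O}(e^{-\beta_t})$. (b) If $\dot\gamma_t=\dot\gamma$ and $\dot\beta_t=\dot\beta$ are constant, $\dot\gamma=e^{\alpha}\le 2\dot\beta\le\frac{2\mu}{C}$, and $C\sqrt{s}\le 2$, then $f(X_t)-f(x^* )\le\mathcal{O}(e^{-\gamma_t})$.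
   Context: $\mathcal{F}_{\mu,L}$ is the class of functions $f:\mathbb{R}^d\to\mathbb{R}$ that are $\mu$-strongly convex and $L$-smooth (the gradient is $L$-Lipschitz). Since the ODE involves the Hessian, $f$ is understood to be twice continuously differentiable. Dots denote time derivatives. $f(X_t)-f(x^* )\le\mathcal{O}(g(t))$ means that there is a constant $K\ge 0$, independent of $t$ (it may depend on the initial data at $t_0$ and on the parameters), such that $f(X_t)-f(x^* )\le K g(t)$ for all $t\ge t_0$. *)

(* Defs.v *)
From HB Require Import structures.
From mathcomp Require Import all_boot all_order all_algebra.
From mathcomp Require Import all_classical all_reals all_analysis.
Set Implicit Arguments.
Unset Strict Implicit.
Unset Printing Implicit Defensive.
Import Order.TTheory GRing.Theory Num.Theory.
Import numFieldNormedType.Exports.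
Local Open Scope classical_set_scope.
Local Open Scope ring_scope.

(* R^d is 'rV[R]_d. The library norm on matrices is the sup norm, hence a
   separate Euclidean norm; both induce the same topology and derivatives. *)
Definition enorm (R : realType) (d : nat) (x : 'rV[R]_d) : R :=
  Num.sqrt (\sum_(i < d) x 0 i ^+ 2).

Definition grad (R : realType) (d : nat) (f : 'rV[R]_d -> R)
    (x : 'rV[R]_d) : 'rV[R]_d :=
  \row_(i < d) 'D_(delta_mx 0 i) f x.

(* Entry (i, j) is the i-th partial derivative of the j-th component of the
   gradient; vectors being rows, the Hessian acts by [v *m hess f x]. *)
Definition hess (R : realType) (d : nat) (f : 'rV[R]_d -> R)
    (x : 'rV[R]_d) : 'M[R]_d :=
  'J (grad f) x.

Definition twice_continuously_differentiable (R : realType) (d : nat)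
    (f : 'rV[R]_d -> R) : Prop :=
  [/\ forall x, differentiable f x,
      forall x, differentiable (grad f) x
    & continuous (hess f)].

Definition strongly_convex (R : realType) (d : nat) (mu : R)
    (f : 'rV[R]_d -> R) : Prop :=
  forall (x y : 'rV[R]_d) (l : R), 0 <= l <= 1 ->
    f (l *: x + (1 - l) *: y) <=
      l * f x + (1 - l) * f y
      - mu / 2 * (l * (1 - l)) * enorm (x - y) ^+ 2.

Definition smooth (R : realType) (d : nat) (L : R)
    (f : 'rV[R]_d -> R) : Prop :=
  (forall x, differentiable f x) /\
  forall x y : 'rV[R]_d, enorm (grad f x - grad f y) <= L * enorm (x - y).

Definition in_class (R : realType) (d : nat) (mu L : R)
    (f : 'rV[R]_d -> R) : Prop :=
  strongly_convex mu f /\ smooth L f.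

Definition unique_minimizer (R : realType) (d : nat)
    (f : 'rV[R]_d -> R) (xs : 'rV[R]_d) : Prop :=
  (forall x, f xs <= f x) /\
  forall y, (forall x, f y <= f x) -> y = xs.

(* Time derivatives are taken on [t0, +oo[: two-sided for t > t0 and
   one-sided at t0, so that nothing is assumed for times before t0. *)
Definition diff_quot (R : realType) (V : normedModType R)
    (g : R -> V) (t : R) : R -> V :=
  fun r => (r - t)^-1 *: (g r - g t).

Definition time_filter (R : realType) (t0 t : R) : set_system R :=
  within `[t0, +oo[%classic t^'.

Definition time_derivable (R : realType) (V : normedModType R) (t0 : R)
    (g : R -> V) : Prop :=
  forall t, t0 <= t -> cvg (diff_quot g t @ time_filter t0 t).

Definition time_deriv (R : realType) (V : normedModType R) (t0 : R)
    (g : R -> V) (t : R) : V :=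
  lim (diff_quot g t @ time_filter t0 t).

Definition time_C1 (R : realType) (V : normedModType R) (t0 : R)
    (g : R -> V) : Prop :=
  time_derivable t0 g /\
  {within `[t0, +oo[%classic, continuous (time_deriv t0 g)}.

Definition ode_solution (R : realType) (d : nat) (f : 'rV[R]_d -> R)
    (C s alpha t0 : R) (beta gamma : R -> R) (X : R -> 'rV[R]_d) : Prop :=
  [/\ time_derivable t0 X,
      time_derivable t0 (time_deriv t0 X)
    & forall t, t0 <= t ->
        let dX := time_deriv t0 X t in
        let ddX := time_deriv t0 (time_deriv t0 X) t in
        let dbeta := time_deriv t0 beta t in
        let dgamma := time_deriv t0 gamma t in
        ddX + (dgamma + dbeta) *: dX
          + Num.sqrt s *: (dX *m hess f (X t))
          + (expR alpha / C + Num.sqrt s * dbeta) *: grad f (X t) = 0].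

Definition bigO_from (R : realType) (t0 : R) (u g : R -> R) : Prop :=
  exists2 K : R, 0 <= K & forall t, t0 <= t -> u t <= K * g t.

(* Main.v *)
Require Import Defs.
From HB Require Import structures.
From mathcomp Require Import all_boot all_order all_algebra.
From mathcomp Require Import all_classical all_reals all_analysis.
From mathcomp Require Import ring lra.
Import Order.TTheory GRing.Theory Num.Theory.
Import numFieldNormedType.Exports.
Local Open Scope classical_set_scope.
Local Open Scope ring_scope.

Set Implicit Arguments.
Unset Strict Implicit.
Unset Printing Implicit Defensive.

(** Write [x = X - xs], [g = grad f X], [F = f X - f xs], [y] for the velocity
    and [sigma = sqrt s].  Both rates come from a Lyapunov energy [E] with
    [E' + B' E <= 0], where [B] is the exponent of the claimed rate; then
    [E expR B] is nonincreasing ([exponential_decay]).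

    For the rate [expR (- beta)] the energy is
    [F + C a / 2 * |x + (y + sigma g) / a|^2].  The combination
    [y + sigma g] absorbs the Hessian, since the derivative of [sigma g] is
    exactly the Hessian damping of the equation.  The energy dominates [F], and
    strong convexity in the form [F + mu / 2 |x|^2 <= <x, g>] makes it decay
    ([damped_motion_rate_beta]).

    For the rate [expR (- gamma)] the energy couples [x] to [y] itself rather
    than to [y + sigma g], so its derivative contains [<x, H y>].  This term is
    compensated by adding a multiple of the Bregman divergence
    [D = <x, g> - F], because [D' = <x, H y>]; see [gamma_energy].  The decay
    uses [mu / 2 |x|^2 <= D] and [mu |y|^2 <= <y, H y>].  The price is that this
    energy need not control [F]: for [f = mu / 2 |x|^2], [a = 2 b = 2 mu / C]
    and [sigma = 0] it equals [|y + a x|^2 / 2].  What it always controls is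
    [|y + a x|^2].  As [y] is the derivative of [x], this says that [x] relaxes
    at rate [a] under a forcing of size [expR (- gamma / 2)], so [|x|^2] is of
    order [expR (- gamma)] ([sqnorm_decay_of_forced_relaxation]).  The energy
    plus a multiple of [|x|^2] does dominate [F].

    Time derivatives are one-sided at the initial time, so the curves are first
    continued to the left by their tangent ([extend]); the usual two-sided
    differential calculus then applies at every [t >= t0]. *)

(** * The Euclidean inner product *)

Definition dot (R : realType) (d : nat) (u v : 'rV[R]_d) : R :=
  \sum_(i < d) u 0 i * v 0 i.

Lemma dotC (R : realType) (d : nat) (u v : 'rV[R]_d) : dot u v = dot v u.
Proof. by apply: eq_bigr => i _; rewrite mulrC. Qed.

Lemma dotDl (R : realType) (d : nat) (u v w : 'rV[R]_d) :
  dot (u + v) w = dot u w + dot v w.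
Proof. by rewrite -big_split; apply: eq_bigr => i _; rewrite mxE mulrDl. Qed.

Lemma dotZl (R : realType) (d : nat) (k : R) (u w : 'rV[R]_d) :
  dot (k *: u) w = k * dot u w.
Proof. by rewrite mulr_sumr; apply: eq_bigr => i _; rewrite mxE mulrA. Qed.

Lemma dotNl (R : realType) (d : nat) (u w : 'rV[R]_d) : dot (- u) w = - dot u w.
Proof. by rewrite -scaleN1r dotZl mulN1r. Qed.

Lemma dotDr (R : realType) (d : nat) (u v w : 'rV[R]_d) :
  dot w (u + v) = dot w u + dot w v.
Proof. by rewrite dotC dotDl !(dotC w). Qed.

Lemma dotZr (R : realType) (d : nat) (k : R) (u w : 'rV[R]_d) :
  dot w (k *: u) = k * dot w u.
Proof. by rewrite dotC dotZl (dotC w). Qed.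

Lemma dotNr (R : realType) (d : nat) (u w : 'rV[R]_d) : dot w (- u) = - dot w u.
Proof. by rewrite dotC dotNl dotC. Qed.

Lemma dot0l (R : realType) (d : nat) (u : 'rV[R]_d) : dot 0 u = 0.
Proof. by rewrite -(scale0r u) dotZl mul0r. Qed.

Definition dotE := (dotDl, dotDr, dotZl, dotZr, dotNl, dotNr).

Lemma dot_ge0 (R : realType) (d : nat) (u : 'rV[R]_d) : 0 <= dot u u.
Proof. by apply: sumr_ge0 => i _; rewrite -expr2 sqr_ge0. Qed.

Lemma enorm_sqr (R : realType) (d : nat) (u : 'rV[R]_d) :
  enorm u ^+ 2 = dot u u.
Proof.
rewrite sqr_sqrtr; first by apply: eq_bigr => i _; rewrite expr2.
by apply: sumr_ge0 => i _; rewrite sqr_ge0.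
Qed.

(** * Chain and product rules *)

Lemma is_derive_dot (R : realType) (V : normedModType R) (d : nat)
    (u v : V -> 'rV[R]_d) (du dv : 'rV[R]_d) (t h : V) :
  is_derive t h u du -> is_derive t h v dv ->
  is_derive t h (fun r => dot (u r) (v r)) (dot du (v t) + dot (u t) dv).
Proof.
move=> hu hv.
have coord (w : V -> 'rV[R]_d) dw i :
    is_derive t h w dw -> is_derive t h (fun r => w r 0 i) (dw 0 i).
  move=> hw; have dw1 : derivable w t h by exact: ex_derive.
  apply: DeriveDef; first by move/derivable_mxP : dw1.
  by have := @derive_val _ _ _ _ _ _ _ hw; rewrite derive_mx// => <-; rewrite mxE.
have -> : (fun r => dot (u r) (v r)) =
    \sum_(i < d) ((fun r => u r 0 i) * (fun r => v r 0 i)).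
  by apply/funext => r; rewrite fct_sumE.
have hi i := is_deriveM (coord _ _ i hu) (coord _ _ i hv).
apply: is_derive_eq (is_derive_sum hi) _.
rewrite /dot -big_split; apply: eq_bigr => i _ /=.
by rewrite /GRing.scale/=; ring.
Qed.

Lemma is_derive_comp (R : realType) (V W : normedModType R) (F : V -> W)
    (u : R -> V) (du : V) (t : R) :
  differentiable F (u t) -> is_derive t 1 u du ->
  is_derive t 1 (fun r => F (u r)) ('D_du F (u t)).
Proof.
move=> dF [du1 <-].
have dfu : differentiable u t by apply/derivable1_diffP.
apply: DeriveDef; first by apply/derivable1_diffP; exact: differentiable_comp.
rewrite deriveE; last exact: differentiable_comp.
by rewrite diff_comp//= !deriveE.
Qed.

Lemma derive_grad (R : realType) (d : nat) (f : 'rV[R]_d -> R)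
    (x v : 'rV[R]_d) :
  differentiable f x -> 'D_v f x = dot v (grad f x).
Proof.
move=> df; rewrite deriveE// [in LHS](row_sum_delta v) linear_sum /dot.
by apply: eq_bigr => i _; rewrite linearZ mxE deriveE.
Qed.

(** * First and second order consequences of strong convexity *)

(** Strong convexity bounds difference quotients up to an error linear in the
    step; the error [k * h] disappears in the limit from the right, which is
    the only part of the derivative that the convexity inequality speaks of. *)
Lemma derive_le_of_quotient (R : realType) (V : normedModType R) (f : V -> R)
    (x v : V) (c k : R) :
  derivable f x v ->
  (forall h, 0 < h <= 1 -> f (h *: v + x) - f x <= h * (c + k * h)) ->
  'D_v f x <= c.
Proof.
move=> df hle.
have hr : (c + k * h) @[h --> 0^'+] --> c.
  rewrite -[X in _ --> X]addr0 -[X in _ --> _ + X](mulr0 k).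
  apply: cvgD; first exact: cvg_cst.
  apply: cvgM; first exact: cvg_cst.
  exact: cvg_at_right_filter.
apply: (ler_cvg_to _ hr); first by apply: cvg_dnbhs_at_right; exact: df.
near=> h.
have h0 : 0 < h by near: h; exact: nbhs_right_gt.
have h1 : h <= 1 by near: h; exact: nbhs_right_le.
by rewrite /GRing.scale/= ler_pdivrMl// hle// h0 h1.
Unshelve. all: by end_near. Qed.

Lemma strongly_convex_lower_bound (R : realType) (d : nat) (mu : R)
    (f : 'rV[R]_d -> R) (x y : 'rV[R]_d) :
  strongly_convex mu f -> differentiable f x ->
  f x + dot (y - x) (grad f x) + mu / 2 * dot (y - x) (y - x) <= f y.
Proof.
move=> sc df; rewrite -derive_grad//.
suff : 'D_(y - x) f x <= f y - f x - mu / 2 * dot (y - x) (y - x) by lra.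
apply: (@derive_le_of_quotient _ _ _ _ _ _ (mu / 2 * dot (y - x) (y - x))).
  exact: diff_derivable.
move=> h /andP[h0 h1].
have -> : h *: (y - x) + x = h *: y + (1 - h) *: x.
  by rewrite scalerBr scalerBl scale1r -addrA [- _ + x]addrC.
have := sc y x h; rewrite (ltW h0) h1 => /(_ isT); rewrite enorm_sqr.
by set N := dot _ _; move: (f _) (f x) (f y) => *; lra.
Qed.

(** Adding the two quadratic lower bounds at [x] and [h *: v + x] gives the
    strong monotonicity of the gradient; dividing by [h] and letting [h] tend
    to 0 gives the bound on the Hessian. *)
Lemma strongly_convex_hess (R : realType) (d : nat) (mu : R)
    (f : 'rV[R]_d -> R) (x v : 'rV[R]_d) :
  strongly_convex mu f -> (forall y, differentiable f y) ->
  differentiable (grad f) x ->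
  mu * dot v v <= dot v (v *m hess f x).
Proof.
move=> sc df dg.
have hd : is_derive x v (fun y => dot (- v) (grad f y)) (- dot v (v *m hess f x)).
  have hg : is_derive x v (grad f) (v *m hess f x).
    apply: DeriveDef; first exact: diff_derivable.
    by rewrite deriveEjacobian.
  apply: is_derive_eq (is_derive_dot (is_derive_cst (- v) x v) hg) _.
  by rewrite dot0l add0r dotNl.
rewrite -lerN2 -(@derive_val _ _ _ _ _ _ _ hd).
apply: (@derive_le_of_quotient _ _ _ _ _ _ 0); first exact: ex_derive.
move=> h /andP[h0 _].
have := strongly_convex_lower_bound (h *: v + x) sc (df x).
have := strongly_convex_lower_bound x sc (df (h *: v + x)).
rewrite addrK opprD addrCA subrr addr0 !dotE.
move: (f _) (f _) (dot v (grad _ _)) (dot v (grad _ _)) => f1 f2 g1 g2 h1 h2.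
have : 0 <= h * (g2 - g1 - h * (mu * dot v v)) by lra.
by rewrite pmulr_rge0// mul0r addr0; lra.
Qed.

(** The quadratic lower bound at the minimizer, whose first order term is
    nonnegative because difference quotients at a minimizer are. *)
Lemma strongly_convex_growth (R : realType) (d : nat) (mu : R)
    (f : 'rV[R]_d -> R) (xs x : 'rV[R]_d) :
  strongly_convex mu f -> (forall y, differentiable f y) ->
  (forall y, f xs <= f y) ->
  mu / 2 * dot (x - xs) (x - xs) <= f x - f xs.
Proof.
move=> sc df hmin.
have := strongly_convex_lower_bound x sc (df xs).
suff : 0 <= dot (x - xs) (grad f xs) by lra.
rewrite -derive_grad// -oppr_le0 -deriveN; last exact: diff_derivable.
apply: (@derive_le_of_quotient _ _ _ _ _ _ 0).
  by apply: derivableN; exact: diff_derivable.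
move=> h _; rewrite mul0r addr0 mulr0.
rewrite /GRing.opp/= subr_le0 lerN2; exact: hmin.
Qed.

(** * Decay from a differential inequality *)

(** The product [u * expR B] is nonincreasing. *)
Lemma exponential_decay (R : realType) (t0 : R) (u du B dB : R -> R) :
  (forall t, t0 <= t -> is_derive t 1 u (du t)) ->
  (forall t, t0 <= t -> is_derive t 1 B (dB t)) ->
  (forall t, t0 <= t -> du t + dB t * u t <= 0) ->
  forall t, t0 <= t -> u t <= u t0 * expR (B t0) * expR (- B t).
Proof.
move=> hu hB hle t ht.
have hd r : t0 <= r -> is_derive r 1 (fun r => u r * expR (B r))
    ((du r + dB r * u r) * expR (B r)).
  move=> hr; have ? := hu r hr; have ? := hB r hr.
  apply: is_derive_eq.
  by rewrite /GRing.scale/=; ring.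
rewrite expRN ler_pdivlMr ?expR_gt0//.
apply: (@ler0_derive1_nincry R (fun r => u r * expR (B r)) t0) => //.
- by move=> r; rewrite in_itv/= andbT => /ltW/hd h; exact: ex_derive.
- move=> r; rewrite in_itv/= andbT => /ltW hr; have h := hd r hr.
  by rewrite derive1E derive_val mulr_le0_ge0 ?expR_ge0 ?hle.
- apply: derivable_within_continuous => r; rewrite in_itv/= andbT => /hd h.
  exact: ex_derive.
Qed.

(** * Curves with one-sided derivatives *)

(** Continuing by the tangent at [t0] makes the left derivative at [t0] agree
    with the right one. *)
Definition extend (R : realType) (V : normedModType R) (t0 : R) (g : R -> V)
    (t : R) : V :=
  if t0 <= t then g t else g t0 + (t - t0) *: time_deriv t0 g t0.

Lemma extendE (R : realType) (V : normedModType R) (t0 : R) (g : R -> V) t :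
  t0 <= t -> extend t0 g t = g t.
Proof. by rewrite /extend => ->. Qed.

Lemma is_derive_extend (R : realType) (V : normedModType R) (t0 : R)
    (g : R -> V) (t : R) :
  time_derivable t0 g -> t0 <= t ->
  is_derive t 1 (extend t0 g) (time_deriv t0 g t).
Proof.
move=> dg ht.
suff hl : (fun h => h^-1 *: ((extend t0 g \o shift t) (h *: 1) - extend t0 g t))
    @ 0^' --> time_deriv t0 g t.
  apply: DeriveDef; first by apply/cvg_ex; exists (time_deriv t0 g t).
  exact: cvg_lim.
have hg : diff_quot g t @ time_filter t0 t --> time_deriv t0 g t by exact: dg.
apply/cvgrPdist_le => e e0.
have {}hg : \forall r \near t, r != t -> t0 <= r ->
    `|time_deriv t0 g t - diff_quot g t r| <= e.
  move/cvgrPdist_le : hg => /(_ e e0); rewrite /time_filter !near_withinE.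
  by apply: filterS => r H h1 h2; apply: H => //; rewrite /= in_itv/= h2.
(* A point [r < t0] is met arbitrarily near [t] only when [t = t0], and there
   the difference quotient of the tangent is constant. *)
have hpast : \forall r \near t, t0 <= r \/ t = t0.
  have [->|ne] := eqVneq t t0; first by near=> r; right.
  have lt : t0 < t by rewrite lt_neqAle eq_sym ne.
  by apply: filterS (lt_nbhsr lt) => r /ltW; left.
have : \forall r \near t, r != t ->
    `|time_deriv t0 g t - diff_quot (extend t0 g) t r| <= e.
  near=> r => rt.
  have rt0 : r - t != 0 by rewrite subr_eq0.
  have [tr|rlt] := leP t0 r.
    by rewrite /diff_quot !extendE//; move: rt tr; near: r.
  have [|tt0] : t0 <= r \/ t = t0 by near: r.
    by rewrite leNgt rlt.
  rewrite /diff_quot (extendE _ ht) /extend [t0 <= r]leNgt rlt/= tt0 [g t0 + _]addrC addrK.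
  by rewrite scalerA mulVf -?tt0// scale1r subrr normr0 ltW.
rewrite (near_shift 0) subr0 near_withinE; apply: filterS => h /= H h0.
have := H; rewrite /diff_quot addrK [_ *: 1]mulr1; apply.
by rewrite -subr_eq0 addrK.
Unshelve. all: by end_near. Qed.
(** * The equation of motion with two-sided derivatives *)

(** The second-order equation as a first-order system in the position [X] and
    the velocity [Y], solved for the acceleration [A].  The constant [a] stands
    both for [expR alpha] and for the derivative of gamma, and [b] for the
    derivative of beta. *)
Definition damped_motion (R : realType) (d : nat) (f : 'rV[R]_d -> R)
    (C sigma a t0 : R) (b : R -> R) (X Y A : R -> 'rV[R]_d) : Prop :=
  forall t, t0 <= t ->
    [/\ is_derive t 1 X (Y t), is_derive t 1 Y (A t)
      & A t = - ((a + b t) *: Y t + sigma *: (Y t *m hess f (X t))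
                 + (a / C + sigma * b t) *: grad f (X t))].

Lemma is_derive_value_along (R : realType) (d : nat) (f : 'rV[R]_d -> R)
    (X : R -> 'rV[R]_d) (y : 'rV[R]_d) (t : R) :
  (forall x, differentiable f x) -> is_derive t 1 X y ->
  is_derive t 1 (fun r => f (X r)) (dot y (grad f (X t))).
Proof.
by move=> df hX; rewrite -derive_grad//; apply: is_derive_comp.
Qed.

Lemma is_derive_grad_along (R : realType) (d : nat) (f : 'rV[R]_d -> R)
    (X : R -> 'rV[R]_d) (y : 'rV[R]_d) (t : R) :
  (forall x, differentiable (grad f) x) -> is_derive t 1 X y ->
  is_derive t 1 (fun r => grad f (X r)) (y *m hess f (X t)).
Proof.
move=> dg hX.
have -> : y *m hess f (X t) = 'D_y (grad f) (X t).
  by rewrite (deriveEjacobian _ (dg (X t))).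
exact: is_derive_comp.
Qed.

(** * Decay at the rate of beta *)

(** With [z = a x + (y + sigma g)] the equation of motion reads
    [z' = - b (y + sigma g) - (a / C) g], without Hessian.  The energy is
    [F + C / (2 a) |z|^2], whose coefficient is the one for which the cross
    terms [<g, y + sigma g>] cancel. *)
Lemma damped_motion_rate_beta (R : realType) (d : nat) (mu : R)
    (f : 'rV[R]_d -> R) (xs : 'rV[R]_d) (C sigma a t0 : R) (B b : R -> R)
    (X Y A : R -> 'rV[R]_d) :
  strongly_convex mu f -> (forall x, differentiable f x) ->
  (forall x, differentiable (grad f) x) -> (forall x, f xs <= f x) ->
  0 < C -> 0 <= sigma -> 0 < a -> a <= mu / C ->
  (forall t, t0 <= t -> is_derive t 1 B (b t)) ->
  (forall t, t0 <= t -> 0 <= b t <= a) ->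
  damped_motion f C sigma a t0 b X Y A ->
  bigO_from t0 (fun t => f (X t) - f xs) (fun t => expR (- B t)).
Proof.
move=> sc df dg hmin C0 s0 a0 aC hB hb hX.
pose z : R -> 'rV[R]_d := fun t => a *: (X t - xs) + (Y t + sigma *: grad f (X t)).
pose k := C / (2 * a).
have k0 : 0 <= k by rewrite divr_ge0 ?mulr_ge0 ?ltW.
pose E t := f (X t) - f xs + k * dot (z t) (z t).
pose dz t := - (b t *: (Y t + sigma *: grad f (X t)) + (a / C) *: grad f (X t)).
pose dE t := dot (Y t) (grad f (X t)) + k * (dot (dz t) (z t) + dot (z t) (dz t)).
have hz t : t0 <= t -> is_derive t 1 z (dz t).
  move=> ht; have [h1 h2 h4] := hX t ht.
  have h5 := is_derive_grad_along dg h1.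
  have hx := is_deriveZ a (is_deriveB h1 (is_derive_cst xs t 1)).
  have h6 := is_deriveD hx (is_deriveD h2 (is_deriveZ sigma h5)).
  apply: is_derive_eq h6 _.
  rewrite h4 /dz subr0; apply/rowP => i; rewrite !mxE; ring.
have hE t : t0 <= t -> is_derive t 1 E (dE t).
  move=> ht; have [h1 h2 h4] := hX t ht.
  have h5 := is_derive_value_along df h1.
  have h6 := is_derive_dot (hz t ht) (hz t ht).
  have h7 := is_deriveD (is_deriveB h5 (is_derive_cst (f xs) t 1)) (is_deriveZ k h6).
  by apply: is_derive_eq h7 _; rewrite subr0.
have dissip t : t0 <= t -> dE t + b t * E t <= 0.
  move=> /hb/andP[b0 ba].
  have hF := hmin (X t).
  have hD := strongly_convex_lower_bound xs sc (df (X t)).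
  have hy := dot_ge0 (Y t + sigma *: grad f (X t)).
  have hx := dot_ge0 (X t - xs).
  have hg := dot_ge0 (grad f (X t)).
  move: hD hx hy hg; rewrite -(opprB (X t) xs) /dE /E /dz /z.
  move: (X t - xs) (Y t) (grad f (X t)) (f (X t)) hF (b t) b0 ba.
  move=> x y g F hF bt b0 ba.
  rewrite !dotE (dotC g x) (dotC y x) (dotC g y).
  move: (dot x x) (dot x y) (dot x g) (dot y y) (dot y g) (dot g g) (f xs) hF.
  move=> xx xy xg yy yg gg fs hF hD hx hy hg.
  rewrite /k -oppr_ge0.
  have Cb : 0 <= mu - C * bt.
    by move: aC; rewrite ler_pdivlMr// => aC; nra.
  (* Each summand is a nonnegative quantity times a nonnegative coefficient:
     [b <= a] for [F], strong convexity for the second one, [C b <= mu] for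
     [|x|^2]; the last one is the square of [y + sigma g]. *)
  rewrite [X in 0 <= X](_ : _ = (a - bt) * (F - fs)
    + a * (xg - (F - fs) - mu / 2 * xx) + a / 2 * ((mu - C * bt) * xx)
    + sigma * gg
    + C / (2 * a) * (bt * (yy + sigma * yg + (sigma * yg + sigma * (sigma * gg)))));
    last by field; rewrite (gt_eqF a0) (gt_eqF C0).
  have hD' : 0 <= xg - (F - fs) - mu / 2 * xx by lra.
  have hy' : 0 <= yy + sigma * yg + (sigma * yg + sigma * (sigma * gg)) by lra.
  have hF' : 0 <= F - fs by rewrite subr_ge0.
  have ba' : 0 <= a - bt by rewrite subr_ge0.
  have a2 : 0 <= a / 2 by lra.
  by do ![done | exact: ltW | exact: k0 | apply: mulr_ge0 | apply: addr_ge0].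
exists (E t0 * expR (B t0)).
  rewrite mulr_ge0 ?expR_ge0// addr_ge0 ?subr_ge0 ?hmin//.
  by rewrite mulr_ge0 ?dot_ge0.
move=> t ht; apply: le_trans (exponential_decay hE hB dissip ht).
by rewrite lerDl mulr_ge0 ?dot_ge0.
Qed.

(** * Decay at the rate of gamma *)

(** Here [c = a / C].  The coefficient of [F] is that of the force, so that
    the terms [<y, g>] cancel; [dot x g - F] is the Bregman divergence of [xs]
    from [X], whose derivative cancels the Hessian term coming from [dot y x].
    The coefficient of [dot x x] is chosen so that the dissipation is a perfect
    square in [y + (a / 2) x] plus nonnegative terms; it becomes negative when
    [a < 2 * sigma * mu]. *)
Definition gamma_energy (R : realType) (d : nat) (c sigma a b mu F : R)
    (x y g : 'rV[R]_d) : R :=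
  (c + sigma * b) * F + a * sigma * (dot x g - F) + 2^-1 * dot y y
  + a * dot y x + (a ^+ 2 / 2 - a * sigma * mu) / 2 * dot x x.

(** The square [|y + a x|^2 / 2] uses up [a * dot y x]; the Bregman term pays
    for the part of the defect in [dot x x] that is proportional to
    [sigma]. *)
Lemma gamma_energy_ge (R : realType) (d : nat) (c sigma a b mu F : R)
    (x y g : 'rV[R]_d) :
  0 <= a -> 0 <= sigma -> mu / 2 * dot x x <= dot x g - F ->
  2^-1 * dot (y + a *: x) (y + a *: x) + (c + sigma * b) * F
    - a ^+ 2 / 4 * dot x x <= gamma_energy c sigma a b mu F x y g.
Proof.
move=> a0 s0; rewrite -subr_ge0 => /(mulr_ge0 (mulr_ge0 a0 s0)).
by rewrite /gamma_energy !dotE (dotC y x); lra.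
Qed.

(** The left-hand side of the conclusion, up to its last summand, is the
    derivative of the energy when [x' = y], [y' = A] and [h] is the derivative
    of [g].  The conditions of the rate enter as follows: [a <= 2 b] for the
    square of [y + (a / 2) x], [a sigma <= 2 c] for the sign of the Bregman
    term when [b < a], and [a b <= mu c] for the remaining multiple of
    [|x|^2]. *)
Lemma gamma_energy_dissipation (R : realType) (d : nat)
    (c sigma a b mu F : R) (x y g h A : 'rV[R]_d) :
  0 <= a -> 0 <= sigma -> 0 <= mu ->
  a <= 2 * b -> a * b <= mu * c -> a * sigma <= 2 * c ->
  mu / 2 * dot x x <= dot x g - F -> mu * dot y y <= dot y h ->
  A = - ((a + b) *: y + sigma *: h + (c + sigma * b) *: g) ->
  (c + sigma * b) * dot y g + a * sigma * (dot y g + dot x h - dot y g)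
    + 2^-1 * (dot A y + dot y A) + a * (dot A x + dot y y)
    + (a ^+ 2 / 2 - a * sigma * mu) / 2 * (dot y x + dot x y)
    + a * gamma_energy c sigma a b mu F x y g <= 0.
Proof.
move=> a0 s0 mu0 ab amu as2 hD hH ->.
have := dot_ge0 (y + (a / 2) *: x); have := dot_ge0 x; move: hD hH.
rewrite /gamma_energy !dotE.
rewrite (dotC h y) (dotC h x) (dotC y x) (dotC g y) (dotC g x).
move: (dot x x) (dot x y) (dot x g) (dot y y) (dot y g) (dot y h) (dot x h).
move=> xx xy xg yy yg yh xh hD hH hx hz.
rewrite -oppr_ge0.
rewrite [X in 0 <= X](_ : _ =
    a * (c + sigma * (b - a)) * (xg - F - mu / 2 * xx)
    + sigma * (yh - mu * yy)
    + (b - a / 2 + sigma * mu) *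
      (yy + a / 2 * xy + (a / 2 * xy + a / 2 * (a / 2 * xx)))
    + a / 2 * (mu * c - a ^+ 2 / 4 - a * b / 2 + sigma * mu * (b - a / 2)) * xx);
  last by field.
have p1 : 0 <= c + sigma * (b - a) by nra.
have p2 : 0 <= xg - F - mu / 2 * xx by lra.
have p3 : 0 <= yh - mu * yy by lra.
have p4 : 0 <= b - a / 2 by lra.
have p5 : 0 <= yy + a / 2 * xy + (a / 2 * xy + a / 2 * (a / 2 * xx)) by lra.
have p6 : 0 <= a / 2 by lra.
have p7 : 0 <= mu * c - a ^+ 2 / 4 - a * b / 2 by nra.
by do ![done | apply: mulr_ge0 | apply: addr_ge0].
Qed.

(** From [x' = - a x + (y + a x)] and Young's inequality,
    [(|x|^2)' <= - (3 / 2) a |x|^2 + (2 / a) |y + a x|^2].  The rate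
    [(3 / 2) a] exceeds that of the forcing, so [M * expR (- B)] is a
    supersolution for large [M]. *)
Lemma sqnorm_decay_of_forced_relaxation (R : realType) (d : nat) (a K t0 : R)
    (B : R -> R) (x y : R -> 'rV[R]_d) :
  0 < a -> 0 <= K ->
  (forall t, t0 <= t -> is_derive t 1 B a) ->
  (forall t, t0 <= t -> is_derive t 1 x (y t)) ->
  (forall t, t0 <= t ->
     dot (y t + a *: x t) (y t + a *: x t) <= K * expR (- B t)) ->
  bigO_from t0 (fun t => dot (x t) (x t)) (fun t => expR (- B t)).
Proof.
move=> a0 K0 hB hx hz.
(* The first summand makes [M * expR (- B)] a supersolution, the second one
   puts it above [|x|^2] at the initial time. *)
pose M := 4 * K / a ^+ 2 + dot (x t0) (x t0) * expR (B t0).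
have K4 : 0 <= 4 * K / a ^+ 2 by rewrite divr_ge0 ?sqr_ge0// mulr_ge0.
have xB0 : 0 <= dot (x t0) (x t0) * expR (B t0).
  by rewrite mulr_ge0 ?dot_ge0 ?expR_ge0.
exists M => [|t ht]; first by rewrite addr_ge0.
pose w t := dot (x t) (x t) - M * expR (- B t).
pose dw t := dot (y t) (x t) + dot (x t) (y t) - M * (expR (- B t) * - a).
have hw r : t0 <= r -> is_derive r 1 w (dw r).
  move=> hr; have hBr := is_deriveN (hB r hr).
  have h1 := @is_derive1_comp R expR (- B) r _ _ (is_derive_expR _) hBr.
  have h2 := is_derive_dot (hx r hr) (hx r hr).
  exact: is_deriveB h2 (is_deriveZ M h1).
have hB' r : t0 <= r -> is_derive r 1 (3 / 2 *: B) (3 / 2 *: a).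
  by move=> hr; exact: is_deriveZ (hB r hr).
have dwle r : t0 <= r -> dw r + (3 / 2 *: a) * w r <= 0.
  move=> hr; rewrite -(pmulr_rle0 _ a0) /w /dw.
  (* This square is Young's inequality for [<x, y + a x>]. *)
  have h1 := dot_ge0 (y r + a *: x r - (a / 2) *: x r).
  have h2 : 4 * K * expR (- B r) <= a ^+ 2 * (M * expR (- B r)).
    rewrite mulrA ler_wpM2r ?expR_ge0// /M mulrDr.
    rewrite [a ^+ 2 * (_ / _)]mulrC divfK ?expf_neq0 ?gt_eqF// lerDl.
    by rewrite mulr_ge0 ?sqr_ge0.
  move: h1 (hz r hr); rewrite /GRing.scale/= !dotE (dotC (y r) (x r)).
  by lra.
rewrite -subr_le0; apply: le_trans (exponential_decay hw hB' dwle ht) _.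
rewrite mulr_le0_ge0 ?expR_ge0// mulr_le0_ge0 ?expR_ge0// /w /M subr_le0.
rewrite mulrDl -[X in _ <= _ + X]mulrA -expRD subrr expR0 mulr1 lerDr.
by rewrite mulr_ge0 ?expR_ge0.
Qed.

Lemma damped_motion_rate_gamma (R : realType) (d : nat) (mu : R)
    (f : 'rV[R]_d -> R) (xs : 'rV[R]_d) (C sigma a b t0 : R) (B : R -> R)
    (X Y A : R -> 'rV[R]_d) :
  strongly_convex mu f -> (forall x, differentiable f x) ->
  (forall x, differentiable (grad f) x) -> (forall x, f xs <= f x) ->
  0 < C -> 0 <= sigma -> 0 < a -> a <= 2 * b -> b <= mu / C ->
  C * sigma <= 2 ->
  (forall t, t0 <= t -> is_derive t 1 B a) ->
  damped_motion f C sigma a t0 (fun=> b) X Y A ->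
  bigO_from t0 (fun t => f (X t) - f xs) (fun t => expR (- B t)).
Proof.
move=> sc df dg hmin C0 s0 a0 ab bC Cs hB hX.
have mu0 : 0 < mu.
  suff : 0 < mu / C by rewrite pmulr_lgt0 ?invr_gt0.
  by lra.
have b0 : 0 < b by lra.
pose c := a / C.
have c0 : 0 < c by rewrite divr_gt0.
have cmu : a * b <= mu * c by rewrite /c mulrCA ler_pM2l.
have cs : a * sigma <= 2 * c by rewrite /c mulrA ler_pdivlMr//; nra.
pose th := c + sigma * b.
have th0 : 0 < th by rewrite ltr_wpDr// mulr_ge0// ltW.
pose x t := X t - xs.
pose g t := grad f (X t).
pose F t := f (X t) - f xs.
pose E t := gamma_energy c sigma a b mu (F t) (x t) (Y t) (g t).
pose h t := Y t *m hess f (X t).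
pose dE t := th * dot (Y t) (g t)
  + a * sigma * (dot (Y t) (g t) + dot (x t) (h t) - dot (Y t) (g t))
  + 2^-1 * (dot (A t) (Y t) + dot (Y t) (A t))
  + a * (dot (A t) (x t) + dot (Y t) (Y t))
  + (a ^+ 2 / 2 - a * sigma * mu) / 2 * (dot (Y t) (x t) + dot (x t) (Y t)).
have hx t : t0 <= t -> is_derive t 1 x (Y t).
  move=> /hX[h1 _ _].
  by apply: is_derive_eq (is_deriveB h1 (is_derive_cst xs t 1)) _; rewrite subr0.
have hF t : t0 <= t -> is_derive t 1 F (dot (Y t) (g t)).
  move=> /hX[h1 _ _]; have h2 := is_derive_value_along df h1.
  by apply: is_derive_eq (is_deriveB h2 (is_derive_cst (f xs) t 1)) _; rewrite subr0.
have hE t : t0 <= t -> is_derive t 1 E (dE t).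
  move=> ht; have [h1 h2 _] := hX t ht.
  have hg := is_derive_grad_along dg h1.
  have e1 := is_deriveZ th (hF t ht).
  have e2 := is_deriveZ (a * sigma)
    (is_deriveB (is_derive_dot (hx t ht) hg) (hF t ht)).
  have e3 := is_deriveZ 2^-1 (is_derive_dot h2 h2).
  have e4 := is_deriveZ a (is_derive_dot h2 (hx t ht)).
  have e5 := is_deriveZ ((a ^+ 2 / 2 - a * sigma * mu) / 2)
    (is_derive_dot (hx t ht) (hx t ht)).
  exact: (is_deriveD (is_deriveD (is_deriveD (is_deriveD e1 e2) e3) e4) e5).
have hD t : mu / 2 * dot (x t) (x t) <= dot (x t) (g t) - F t.
  have := strongly_convex_lower_bound xs sc (df (X t)).
  by rewrite -(opprB (X t) xs) -/(x t) -/(g t) /F !dotE; lra.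
have hG t : mu / 2 * dot (x t) (x t) <= F t by exact: strongly_convex_growth.
have dissip t : t0 <= t -> dE t + a * E t <= 0.
  move=> ht; have [_ _ hA] := hX t ht.
  apply: gamma_energy_dissipation hA => //; [exact: ltW|exact: ltW|].
  exact: strongly_convex_hess.
have lower t : 2^-1 * dot (Y t + a *: x t) (Y t + a *: x t) + th * F t
    - a ^+ 2 / 4 * dot (x t) (x t) <= E t.
  by apply: gamma_energy_ge => //; exact: ltW.
have thF t : a ^+ 2 / 4 * dot (x t) (x t) <= th * F t.
  have := hG t; rewrite -subr_ge0 => /(mulr_ge0 (ltW th0)).
  have sb : 0 <= sigma * b * mu by rewrite !mulr_ge0// ltW.
  have : 0 <= th * mu / 2 - a ^+ 2 / 4 by rewrite /th; nra.
  by move=> /mulr_ge0 /(_ (dot_ge0 (x t))); lra.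
have E0 t : 0 <= E t.
  have := dot_ge0 (Y t + a *: x t); have := lower t; have := thF t.
  by lra.
pose K := E t0 * expR (B t0).
have K0 : 0 <= K by rewrite mulr_ge0 ?expR_ge0.
have decay t : t0 <= t -> E t <= K * expR (- B t).
  exact: (exponential_decay hE hB dissip).
have [| |M M0 hM] :=
    @sqnorm_decay_of_forced_relaxation _ _ a (2 * K) t0 B x Y a0 _ hB hx _.
- by rewrite mulr_ge0.
- move=> t ht; have := decay t ht; have := lower t; have := thF t.
  by lra.
exists ((K + a ^+ 2 / 4 * M) / th).
  by rewrite divr_ge0 ?(ltW th0)// addr_ge0// mulr_ge0// divr_ge0// sqr_ge0.
move=> t ht; rewrite -/(F t) mulrAC ler_pdivlMr//.
have := dot_ge0 (Y t + a *: x t); have := lower t; have := decay t ht.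
have := ler_wpM2l (_ : 0 <= a ^+ 2 / 4) (hM t ht).
by rewrite divr_ge0 ?sqr_ge0// => /(_ isT); lra.
Qed.

(** * The two rates *)

Lemma ode_solution_damped_motion (R : realType) (d : nat)
    (f : 'rV[R]_d -> R) (C s alpha t0 : R) (beta gamma : R -> R)
    (X : R -> 'rV[R]_d) :
  (forall t, t0 <= t -> time_deriv t0 gamma t = expR alpha) ->
  ode_solution f C s alpha t0 beta gamma X ->
  damped_motion f C (Num.sqrt s) (expR alpha) t0 (time_deriv t0 beta)
    (extend t0 X) (extend t0 (time_deriv t0 X))
    (time_deriv t0 (time_deriv t0 X)).
Proof.
move=> hgamma [dX ddX ode] t ht; split.
- by rewrite (extendE _ ht); exact: is_derive_extend.
- exact: is_derive_extend.
- rewrite !(extendE _ ht); have := ode t ht; rewrite hgamma//= -!addrA.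
  by move/eqP; rewrite addr_eq0 => /eqP.
Qed.

Theorem theorem1 (R : realType) (d : nat) (mu L : R)
    (f : 'rV[R]_d -> R) (xs : 'rV[R]_d)
    (C s alpha t0 : R) (beta gamma : R -> R) (X : R -> 'rV[R]_d)
    (hmu : 0 < mu) (hmuL : mu <= L)
    (hf : in_class mu L f)
    (hf2 : twice_continuously_differentiable f)
    (hxs : unique_minimizer f xs)
    (hC : 0 < C) (hs : 0 <= s)
    (hbeta : time_C1 t0 beta) (hgamma : time_C1 t0 gamma)
    (hX : ode_solution f C s alpha t0 beta gamma X) :
  (forall dgamma : R,
     (forall t, t0 <= t -> time_deriv t0 gamma t = dgamma) ->
     (forall t, t0 <= t -> 0 <= time_deriv t0 beta t <= dgamma) ->
     dgamma = expR alpha ->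
     expR alpha <= mu / C ->
     bigO_from t0 (fun t => f (X t) - f xs) (fun t => expR (- beta t)))
  /\
  (forall dgamma dbeta : R,
     (forall t, t0 <= t -> time_deriv t0 gamma t = dgamma) ->
     (forall t, t0 <= t -> time_deriv t0 beta t = dbeta) ->
     dgamma = expR alpha ->
     expR alpha <= 2 * dbeta ->
     2 * dbeta <= 2 * mu / C ->
     C * Num.sqrt s <= 2 ->
     bigO_from t0 (fun t => f (X t) - f xs) (fun t => expR (- gamma t))).
Proof.
have [sc [df _]] := hf; have [_ dg _] := hf2; have [hmin _] := hxs.
have a0 := expR_gt0 alpha; have s0 := sqrtr_ge0 s.
have onX (B : R -> R) : bigO_from t0 (fun t => f (extend t0 X t) - f xs)
      (fun t => expR (- extend t0 B t)) ->
    bigO_from t0 (fun t => f (X t) - f xs) (fun t => expR (- B t)).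
  move=> [K K0 hK]; exists K => // t ht.
  by have := hK t ht; rewrite !(extendE _ ht).
split=> [a hg hb aE|a b hg hb aE]; subst a.
- move=> aC; apply: onX => //.
  apply: (damped_motion_rate_beta sc df dg hmin hC s0 a0 aC _ hb).
    by move=> t ht; exact: is_derive_extend hbeta.1 ht.
  exact: ode_solution_damped_motion hg hX.
- move=> ab bC Cs; apply: onX => //.
  have bC' : b <= mu / C by rewrite -mulrA ler_pM2l in bC.
  have hX' : damped_motion f C (Num.sqrt s) (expR alpha) t0 (fun=> b)
      (extend t0 X) (extend t0 (time_deriv t0 X))
      (time_deriv t0 (time_deriv t0 X)).
    move=> t ht; have [h1 h2 h3] := ode_solution_damped_motion hg hX ht.
    by split=> //; rewrite h3 hb.
  apply: (damped_motion_rate_gamma sc df dg hmin hC s0 a0 ab bC' Cs _ hX').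
  by move=> t ht; rewrite -(hg t ht); exact: is_derive_extend hgamma.1 ht.
Qed.
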